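(* Let $a_w:\mathcal{EF}\to\mathbb R$ be the coefficient map of a numerical method on planar exotic forests, let $A:\mathcal I_{\mathcal R}\to\mathcal{EF}$ be the operator defined in the context on the span $\mathcal I_{\mathcal R}$ of the irreducible forests, and let $a_{\mu_\infty}=a_w\circ A:\mathcal I_{\mathcal R}\to\mathbb R$. Then $a_{\mu_\infty}$ is a character for the modified shuffle product $$\tilde{\sqcup\!\sqcup}:(\pi_1,\pi_2)\mapsto A^{-1}(A\pi_1\sqcup\!\sqcup A\pi_2)=(A\pi_1\sqcup\!\sqcup A\pi_2)-\mathrm{IBP}^*(A\pi_1\sqcup\!\sqcup A\pi_2),$$ that is, for all irreducible forests $\pi_1,\pi_2\in I_R$, $$a_{\mu_\infty}(\pi_1)\,a_{\mu_\infty}(\pi_2)=a_{\mu_\infty}(\pi_1\,\tilde{\sqcup\!\sqcup}\,\pi_2).$$ (Since $a_{\mu_\infty}$ is defined on $\mathcal I_{\mathcal R}$ only, this includes that $A\pi_1\sqcup\!\sqcup A\pi_2$ lies in the image of $A$, i.e. that $\pi_1\,\tilde{\sqcup\!\sqcup}\,\pi_2\in\mathcal I_{\mathcal R}$.)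
   Context: Planar exotic forests. A planar forest is an ordered (possibly empty) list of planar rooted trees (children of each vertex are ordered). A planar exotic forest is a planar forest with vertices decorated by $\{\bullet\}\cup\{1,2,\dots\}$ such that each integer that occurs decorates exactly two vertices, and both are leaves (a one-vertex tree is a leaf); forests differing only by a renaming of integers are identified. A pair of vertices with the same integer is a liana. $EF$ is the set of planar exotic forests, $\mathcal{EF}=\mathrm{Span}_{\mathbb R}(EF)$. The order $|\pi|$ is the number of $\bullet$ vertices plus the number of lianas; there are finitely many forests of each order. The shuffle product $\pi_1\sqcup\!\sqcup\,\pi_2$ is the sum of all interleavings of the two ordered lists of trees (after renaming integers so that $\pi_1$ and $\pi_2$ share none), extended bilinearly. $I_R\subset EF$ is the set of exotic forests whose first (leftmost) tree is not a single integer-decorated vertex (irreducible forests); $\mathcal I_{\mathcal R}=\mathrm{Span}_{\mathbb R}(I_R)$. If $\pi\notin I_R$, write $\pi=n\,\tilde\pi$, with $n$ the first root and $\tilde\pi$ the remaining decorated forest. The linear map $\mathrm{IBP}:\mathcal{EF}\to\mathcal{EF}$ is $0$ on $I_R$, and for $\pi=n\tilde\pi\notin I_R$, $\mathrm{IBP}(\pi)=-\tilde\pi|_{n\to\bullet}-\sum_{v}\tilde\pi|_{n\curvearrowright v}$, where $\tilde\pi|_{n\to\bullet}$ replaces the unique vertex decorated by $n$ in $\tilde\pi$ by $\bullet$, the sum runs over the $\bullet$-vertices $v$ of $\tilde\pi$, and $\tilde\pi|_{n\curvearrowright v}$ adds a new leaf decorated by $n$ as leftmost child of $v$. $\mathrm{RED}=\lim_{m\to\infty}(\mathrm{id}_{\mathcal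 I_{\mathcal R}}+\mathrm{IBP})^m$ (limit of a stationary sequence), with $\mathrm{id}_{\mathcal I_{\mathcal R}}$ the identity on irreducible forests and $0$ on the others. $\langle\cdot|\cdot\rangle$ is the bilinear pairing on $\mathcal{EF}$ for which $EF$ is orthonormal; $\mathrm{IBP}^*$ is the adjoint of IBP for this pairing. The operator $A:\mathcal I_{\mathcal R}\to\mathcal{EF}$ is the linear map given, for $\pi\in I_R$, by $$A\pi=\sum_{\tilde\pi\in EF}\langle\pi|\mathrm{RED}(\tilde\pi)\rangle\,\tilde\pi=\sum_{k\ge0}\sum_{\tilde\pi\in EF}\langle\pi|\mathrm{IBP}^k(\tilde\pi)\rangle\,\tilde\pi .$$ It is invertible (onto its image), with inverse $A^{-1}=\mathrm{id}-\mathrm{IBP}^*$. Coefficient map: for a numerical one-step method with step size $h$ and first step $X_1$ from $X_0$, $a_w$ is the linear map on $\mathcal{EF}$ with $\mathbb E[\varphi(X_1)|X_0=x]=\sum_{\pi\in EF}h^{|\pi|}a_w(\pi)\,\mathbb F^F(\pi)\varphi(x)$ (formal series in $h$, $\varphi$ a test function), where $\mathbb F^F(\pi)$ is the differential operator attached to the forest $\pi$. The map $a_w$ is a character for the shuffle product: $a_w(\pi_1)a_w(\pi_2)=a_w(\pi_1\sqcup\!\sqcup\,\pi_2)$; this is the only property of $a_w$ that is used. *)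

(* Defs.v *)
From HB Require Import structures.
From mathcomp Require Import all_boot all_order all_algebra.
From mathcomp Require Import generic_quotient finmap.
From mathcomp Require Import boolp classical_sets fsbigop reals.
From mathcomp Require Import monalg.

Set Implicit Arguments.
Unset Strict Implicit.
Unset Printing Implicit Defensive.

Import GRing.Theory.
Local Open Scope ring_scope.

(* Vertices decorated by an integer are leaves, so [Lbl] takes no children;
   [Bullet ts] is a vertex decorated by the bullet with ordered children [ts]. *)
Inductive dtree := Lbl of nat | Bullet of seq dtree.

Definition dforest := seq dtree.

Fixpoint encode_dtree (t : dtree) : GenTree.tree nat :=
  match t with
  | Lbl n => GenTree.Leaf n
  | Bullet ts => GenTree.Node 0 [seq encode_dtree u | u <- ts]
  end.

Fixpoint decode_dtree (t : GenTree.tree nat) : dtree :=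
  match t with
  | GenTree.Leaf n => Lbl n
  | GenTree.Node _ ts => Bullet [seq decode_dtree u | u <- ts]
  end.

Fixpoint dtree_nested_ind (P : dtree -> Prop)
    (PLbl : forall n, P (Lbl n))
    (PBullet : forall ts, foldr (fun u Q => P u /\ Q) True ts -> P (Bullet ts))
    (t : dtree) : P t :=
  match t with
  | Lbl n => PLbl n
  | Bullet ts => PBullet ts
     ((fix loop (s : seq dtree) : foldr (fun u Q => P u /\ Q) True s :=
         match s with
         | [::] => I
         | u :: s' => conj (dtree_nested_ind PLbl PBullet u) (loop s')
         end) ts)
  end.

Lemma encode_dtreeK : cancel encode_dtree decode_dtree.
Proof.
elim/dtree_nested_ind => //= ts; rewrite -map_comp => IHts; congr Bullet.
by elim: ts IHts => //= u ts IH [-> /IH ->].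
Qed.

HB.instance Definition _ := Countable.copy dtree (can_type encode_dtreeK).

Fixpoint tlabels (t : dtree) : seq nat :=
  match t with
  | Lbl n => [:: n]
  | Bullet ts => flatten [seq tlabels u | u <- ts]
  end.

Definition labels (f : dforest) : seq nat := flatten [seq tlabels u | u <- f].

Definition exotic (f : dforest) : bool :=
  all (fun n => count_mem n (labels f) == 2%N) (labels f).

Fixpoint trename (s : nat -> nat) (t : dtree) : dtree :=
  match t with
  | Lbl n => Lbl (s n)
  | Bullet ts => Bullet [seq trename s u | u <- ts]
  end.

Definition rename (s : nat -> nat) (f : dforest) : dforest :=
  [seq trename s u | u <- f].

Lemma rename_id f : rename id f = f.
Proof.
have tid t : trename id t = t.
  elim/dtree_nested_ind: t => //= ts IHts; congr Bullet.
  by elim: ts IHts => //= u ts IH [-> /IH ->].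
by rewrite /rename (eq_map tid) map_id.
Qed.

Lemma rename_comp s s' f : rename s (rename s' f) = rename (s \o s') f.
Proof.
have tcomp t : trename s (trename s' t) = trename (s \o s') t.
  elim/dtree_nested_ind: t => //= ts IHts; congr Bullet.
  by elim: ts IHts => //= u ts IH [-> /IH ->].
by rewrite /rename -map_comp (eq_map tcomp).
Qed.

Lemma labels_rename s f : labels (rename s f) = map s (labels f).
Proof.
have tl t : tlabels (trename s t) = map s (tlabels t).
  elim/dtree_nested_ind: t => //= ts IHts.
  by elim: ts IHts => //= u ts IH [-> /IH ->]; rewrite map_cat.
by elim: f => //= t f IH; rewrite /labels /= map_cat tl; congr cat.
Qed.

Lemma exotic_rename s f : injective s -> exotic f -> exotic (rename s f).
Proof.
move=> sI /allP ef; apply/allP => n; rewrite labels_rename => /mapP[m mf ->].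
by rewrite count_map -(eqP (ef m mf)); apply/eqP/eq_count => k /=; exact: inj_eq.
Qed.

Definition xforest := {f : dforest | exotic f}.

(* A forest has finitely many labels, so every injective renaming of its labels
   is the restriction of a bijection of [nat]. *)
Definition renaming (f g : xforest) : bool :=
  `[< exists2 s : nat -> nat, bijective s & val g = rename s (val f) >].

Lemma renaming_refl : reflexive renaming.
Proof. by move=> f; apply/asboolP; exists id; [exists id | rewrite rename_id]. Qed.

Lemma renaming_sym : symmetric renaming.
Proof.
suff sub f g : renaming f g -> renaming g f by move=> f g; apply/idP/idP; exact: sub.
move=> /asboolP[s [s' sK s'K] gE]; apply/asboolP; exists s'; first by exists s.
by rewrite gE rename_comp -[LHS]rename_id; apply: eq_map => t;
  congr trename; apply/funext => n /=; rewrite sK.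
Qed.

Lemma renaming_trans : transitive renaming.
Proof.
move=> g f h /asboolP[s sB gE] /asboolP[s' s'B hE]; apply/asboolP.
by exists (s' \o s); [exact: bij_comp | rewrite hE gE rename_comp].
Qed.

Canonical renaming_equiv :=
  EquivRel renaming renaming_refl renaming_sym renaming_trans.

Definition EF := {eq_quot renaming}%qT.
HB.instance Definition _ := Choice.on EF.
HB.instance Definition _ := EqQuotient.on EF.

Definition empty_xforest : xforest := exist _ [::] isT.

(* The class of a decorated forest; junk if [f] is not exotic. Below it is only
   applied to exotic forests, by [exotic_interleave], [exotic_bulletize] and
   [exotic_graft]. *)
Definition class (f : dforest) : EF := (\pi_EF (insubd empty_xforest f))%qT.

(* Every construction below commutes with renamings, so that its value does not
   depend on the representative chosen here. *)
Definition rep (p : EF) : dforest := val (repr p).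

Definition EFspan (R : realType) := {malg R[EF]}.

Definition pairing (R : realType) (K : choiceType) (x y : {malg R[K]}) : R :=
  \sum_(k <- msupp x) x@_k * y@_k.

Definition lin_ext (R : realType) (K : choiceType) (V : lmodType R) (F : K -> V)
    (x : {malg R[K]}) : V :=
  \sum_(k <- msupp x) x@_k *: F k.

Fixpoint interleave (T : Type) (s : seq T) : seq T -> seq (seq T) :=
  if s is x :: s' then
    fix loop (t : seq T) : seq (seq T) :=
      if t is y :: t' then
        [seq x :: u | u <- interleave s' t] ++ [seq y :: u | u <- loop t']
      else [:: s]
  else fun t => [:: t].

Lemma interleave_perm (T : eqType) (s t u : seq T) :
  u \in interleave s t -> perm_eq u (s ++ t).
Proof.
elim: s t u => [|x s IHs] /=; first by move=> t u; rewrite inE => /eqP->.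
elim=> [|y t IHt] u; first by rewrite inE cats0 => /eqP->.
rewrite mem_cat => /orP[] /mapP[v vI ->].
  by rewrite perm_cons IHs.
apply/permP => P; have /permP/(_ P) := IHt _ vI; rewrite /= !count_cat /= => ->.
by rewrite addnCA; congr addn; rewrite addnCA.
Qed.

Lemma exotic_interleave (p q : EF) (f : dforest) :
  f \in interleave (rename double (rep p)) (rename (succn \o double) (rep q)) ->
  exotic f.
Proof.
move=> /interleave_perm fE.
have lE : perm_eq (labels f) (labels (rename double (rep p)) ++
                              labels (rename (succn \o double) (rep q))).
  rewrite /labels -flatten_cat -map_cat.
  exact/perm_flatten/perm_map.
have ep : exotic (rename double (rep p)).
  by apply: exotic_rename (valP (repr p)); exact: double_inj.
have eq_ : exotic (rename (succn \o double) (rep q)).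
  by apply: exotic_rename (valP (repr q)) => m n /succn_inj/double_inj.
apply/allP => n; rewrite (perm_mem lE) mem_cat => nI.
have := permP lE (pred1 n) => ->; rewrite count_cat.
case/orP: nI => nI.
  rewrite (eqP (allP ep n nI)) (count_memPn _) //.
  move: nI; rewrite !labels_rename => /mapP[m _ ->].
  by apply/negP => /mapP[k _ /(congr1 odd)] /=; rewrite !odd_double.
rewrite (eqP (allP eq_ n nI)) (count_memPn _) //.
move: nI; rewrite !labels_rename => /mapP[m _ ->].
by apply/negP => /mapP[k _ /(congr1 odd)] /=; rewrite !odd_double.
Qed.

(* Even and odd labels make the labels of the two factors disjoint. *)
Definition shuffle_basis (R : realType) (p q : EF) : EFspan R :=
  \sum_(f <- interleave (rename double (rep p))
                        (rename (succn \o double) (rep q))) << class f >>.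

Definition shuffle (R : realType) (x y : EFspan R) : EFspan R :=
  lin_ext (fun p => lin_ext (fun q => shuffle_basis R p q) y) x.

Definition irreducible_raw (f : dforest) : bool :=
  if f is Lbl _ :: _ then false else true.

Definition irreducible (p : EF) : bool := irreducible_raw (rep p).

Fixpoint tbulletize (n : nat) (t : dtree) : dtree :=
  match t with
  | Lbl m => if m == n then Bullet [::] else Lbl m
  | Bullet ts => Bullet [seq tbulletize n u | u <- ts]
  end.

Definition bulletize (n : nat) (f : dforest) : dforest :=
  [seq tbulletize n u | u <- f].

(* All the lists obtained from [s] by replacing exactly one element [x] of [s]
   by an element of [F x]. *)
Definition replace_one (T : Type) (F : T -> seq T) : seq T -> seq (seq T) :=
  fix loop (s : seq T) : seq (seq T) :=
    if s is x :: s' then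
      [seq y :: s' | y <- F x] ++ [seq x :: u | u <- loop s']
    else [::].

(* One tree for each bullet vertex of [t], with the new leaf [Lbl n] as leftmost
   child of that vertex. *)
Fixpoint tgraft (n : nat) (t : dtree) : seq dtree :=
  match t with
  | Lbl _ => [::]
  | Bullet ts =>
      Bullet (Lbl n :: ts) :: [seq Bullet us | us <- replace_one (tgraft n) ts]
  end.

Definition graft (n : nat) (f : dforest) : seq dforest :=
  replace_one (tgraft n) f.

Lemma count_labels_bulletize m n (f : dforest) :
  count_mem m (labels (bulletize n f)) =
  if m == n then 0%N else count_mem m (labels f).
Proof.
have tc t : count_mem m (tlabels (tbulletize n t)) =
    if m == n then 0%N else count_mem m (tlabels t).
  elim/dtree_nested_ind: t => [k|ts IHts] /=.
    have [->|kn] := eqP (x := k) (y := n); rewrite /= ?[n == m]eq_sym.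
      by case: (m == n).
    by have [->|//] := eqP (x := m); rewrite (introF eqP kn).
  elim: ts IHts => [|u ts IH] /=; first by case: ifP.
  by move=> [uE /IH tsE]; rewrite !count_cat uE tsE; case: ifP.
elim: f => [|t f IH]; first by rewrite /labels /=; case: ifP.
rewrite /labels /= !count_cat tc; by move: IH; rewrite /labels => ->; case: ifP.
Qed.

Lemma exotic_bulletize n (f : dforest) :
  exotic (Lbl n :: f) -> exotic (bulletize n f).
Proof.
move=> /allP ef; apply/allP => m.
rewrite -has_pred1 has_count count_labels_bulletize; case: eqP => // mn mI.
have /ef : m \in labels (Lbl n :: f).
  by rewrite inE -has_pred1 has_count mI orbT.
by rewrite /labels /= [n == m]eq_sym; move/eqP/negbTE: mn => ->.
Qed.

Lemma labels_graft n (f g : dforest) :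
  g \in graft n f -> perm_eq (labels g) (n :: labels f).
Proof.
suff [] : (forall t u, u \in tgraft n t -> perm_eq (tlabels u) (n :: tlabels t))
    /\ (forall ts us, foldr (fun t Q => (forall u, u \in tgraft n t ->
          perm_eq (tlabels u) (n :: tlabels t)) /\ Q) True ts ->
        us \in replace_one (tgraft n) ts ->
        perm_eq (labels us) (n :: labels ts)).
  by move=> H1; apply; elim: f => //= t f IH; split; [exact: H1 | ].
have Hs ts us : foldr (fun t Q => (forall u, u \in tgraft n t ->
      perm_eq (tlabels u) (n :: tlabels t)) /\ Q) True ts ->
    us \in replace_one (tgraft n) ts -> perm_eq (labels us) (n :: labels ts).
  elim: ts us => //= t ts IH us [Ht Hts].
  rewrite mem_cat => /orP[] /mapP[v vI ->]; rewrite /labels /=.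
    by rewrite -cat_cons perm_cat2r Ht.
  rewrite -(cat1s n) perm_sym perm_catCA perm_cat2l perm_sym.
  exact: IH vI.
split=> //; elim/dtree_nested_ind => //= ts IH u.
rewrite inE => /orP[/eqP-> // | /mapP[us usI ->]].
exact: Hs IH usI.
Qed.

Lemma exotic_graft n (f g : dforest) :
  exotic (Lbl n :: f) -> g \in graft n f -> exotic g.
Proof.
move=> /allP ef /labels_graft gE; apply/allP => m.
by rewrite (perm_mem gE) (permP gE) => /ef.
Qed.

Definition IBP_basis (R : realType) (p : EF) : EFspan R :=
  if rep p is Lbl n :: f then
    - << class (bulletize n f) >> - \sum_(g <- graft n f) << class g >>
  else 0.

Definition IBP (R : realType) : EFspan R -> EFspan R := lin_ext (IBP_basis R).

Definition id_IR (R : realType) : EFspan R -> EFspan R :=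
  lin_ext (fun p => if irreducible p then << p >> else 0).

(* The eventual value of a stationary sequence, and 0 if there is none. *)
Definition stationary_lim (V : nmodType) (u : nat -> V) : V :=
  xget 0 [set l | exists N, forall m, (N <= m)%N -> u m = l]%classic.

Definition RED (R : realType) (x : EFspan R) : EFspan R :=
  stationary_lim (fun m => iter m (fun y => id_IR y + IBP y) x).

(* The adjoint for [pairing]; the value is unique since [pairing] is
   nondegenerate. *)
Definition adjoint (R : realType) (F : EFspan R -> EFspan R) (x : EFspan R) : EFspan R :=
  xget 0 [set z | forall y, pairing z y = pairing x (F y)]%classic.

Definition IRF := {p : EF | irreducible p}.

Definition IRspan (R : realType) := {malg R[IRF]}.

Definition incl (R : realType) : IRspan R -> EFspan R :=
  lin_ext (fun p : IRF => << val p >>).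

(* The support of the sum is finite, since [RED] preserves the order (the number
   of bullets plus the number of lianas). *)
Definition opA (R : realType) : IRspan R -> EFspan R :=
  lin_ext (fun p : IRF =>
    \sum_(q \in [set: EF]%classic) pairing << val p >> (RED << q >> : EFspan R) *: << q >>).

(* The inverse of [opA] on its image, and 0 elsewhere. *)
Definition opA_inv (R : realType) (y : EFspan R) : IRspan R :=
  xget 0 [set x | opA x = y]%classic.

Definition mod_shuffle (R : realType) (x y : IRspan R) : IRspan R :=
  opA_inv (shuffle (opA x) (opA y)).

Definition is_shuffle_character (R : realType) (a : EFspan R -> R) : Prop :=
  forall p q : EF, a << p >> * a << q >> = a (shuffle << p >> << q >>).

Definition a_mu (R : realType) (a : EFspan R -> R) : IRspan R -> R := a \o @opA R.

(* Main.v *)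
(* A vector x is in the image of A exactly when <x|q> = <x|IBP q> for every
   reducible q; then A is inverted by restricting x to the irreducible forests.
   Dually to the shuffle, the coefficient of x sh y at a forest f is the sum of
   x(u) y(v) over the divisions of the list of trees of f into two exotic
   sublists u and v. If f starts with the root n, the other vertex n lies in the
   same sublist, and a bullet receiving n lies there too, so that IBP is a
   derivation for these divisions and the shuffle of two vectors in the image of
   A is again in the image. The sums are finite because IBP preserves the order,
   and RED exists because IBP lowers the number of trees. *)
Require Import Defs.
From HB Require Import structures.
From mathcomp Require Import all_boot all_order all_algebra.
From mathcomp Require Import generic_quotient.
From mathcomp Require Import finmap boolp classical_sets fsbigop reals monalg.
From mathcomp Require Import zify.

Set Implicit Arguments.
Unset Strict Implicit.
Unset Printing Implicit Defensive.

Import GRing.Theory.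
Local Open Scope ring_scope.

(** * Renamings *)

Lemma swap_bijective (T : eqType) (a b : T) :
  bijective (fun x => if x == a then b else if x == b then a else x).
Proof.
set h := fun x => _; have hK : cancel h h.
  move=> x; rewrite /h; have [->|xa] := eqVneq x a.
    by rewrite eqxx; case: eqVneq.
  have [->|xb] := eqVneq x b; first by rewrite eqxx.
  by rewrite (negbTE xa) (negbTE xb).
by exists h.
Qed.

(** Classes are defined by bijections of all labels; this reduces questions about them to renamings
    injective on the finitely many labels that occur. *)
Lemma extend_bijective (T : eqType) (l : seq T) (s : T -> T) :
  {in l &, injective s} -> exists2 s', bijective s' & {in l, s' =1 s}.
Proof.
elim: l => [|x l IH] sI; first by exists id => //; exists id.
have [|s1 s1B s1E] := IH.
  by move=> y z yl zl; apply: sI; rewrite inE ?yl ?zl orbT.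
have [xl|xl] := boolP (x \in l).
  by exists s1 => // y; rewrite inE => /predU1P[->|]; exact: s1E.
(* Composing with the transposition of [s1 x] and [s x] corrects the value at [x]. It fixes the
   values on [l]: they avoid [s1 x] by injectivity of [s1], and [s x] by that of [s]. *)
exists ((fun y => if y == s1 x then s x else if y == s x then s1 x else y) \o s1).
  by apply: bij_comp => //; exact: swap_bijective.
move=> y; rewrite inE => /predU1P[->|yl] /=; first by rewrite eqxx.
rewrite (bij_eq s1B); have [yx|yx] := eqVneq y x; first by rewrite -yx yl in xl.
rewrite s1E //; case: eqVneq => // /sI e.
by rewrite e ?inE ?eqxx ?yl ?orbT in yx *.
Qed.

Lemma trename_in (s s' : nat -> nat) t :
  {in tlabels t, s =1 s'} -> trename s t = trename s' t.
Proof.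
elim/dtree_nested_ind: t => [n|ts IH] /= e; first by rewrite e ?inE.
congr Bullet; elim: ts IH e => //= u ts IH [uE tsE] e; congr cons.
  by apply: uE => n nu; apply: e; rewrite mem_cat nu.
by apply: IH => // n nu; apply: e; rewrite mem_cat nu orbT.
Qed.

Lemma rename_in (s s' : nat -> nat) f :
  {in labels f, s =1 s'} -> rename s f = rename s' f.
Proof.
move=> e; apply/eq_in_map => t tf; apply: trename_in => n nt; apply: e.
by apply/flattenP; exists (tlabels t) => //; apply: map_f.
Qed.

Lemma exotic_rename_in s f :
  {in labels f &, injective s} -> exotic f -> exotic (rename s f).
Proof.
move=> /extend_bijective[s' s'B e] ef; rewrite -(rename_in e).
by apply: exotic_rename => //; exact: bij_inj.
Qed.

Lemma exotic_rep p : exotic (rep p).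
Proof. exact: valP. Qed.

Lemma class_rep p : class (rep p) = p.
Proof. by rewrite /class /rep valKd reprK. Qed.

Lemma class_eqP f g : exotic f -> exotic g ->
  class f = class g <-> exists2 s, bijective s & g = rename s f.
Proof.
move=> ef eg; rewrite /class; split.
  move=> /eqmodP /= /asboolP[s sB]; rewrite !insubdK // => ->; by exists s.
by move=> [s sB gE]; apply/eqmodP/asboolP; exists s => //; rewrite !insubdK.
Qed.

Lemma class_rename s f :
  {in labels f &, injective s} -> exotic f -> class (rename s f) = class f.
Proof.
move=> sI ef; apply/esym/class_eqP => //; first exact: exotic_rename_in.
by have [s' s'B e] := extend_bijective sI; exists s' => //; rewrite (rename_in e).
Qed.

Lemma rep_class f : exotic f ->
  exists2 s, bijective s & rep (class f) = rename s f.
Proof.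
move=> ef; apply/class_eqP => //; first exact: exotic_rep.
by rewrite class_rep.
Qed.

Lemma labels_cat f g : labels (f ++ g) = labels f ++ labels g.
Proof. by rewrite /labels map_cat flatten_cat. Qed.

Lemma perm_labels f g : perm_eq f g -> perm_eq (labels f) (labels g).
Proof. by move=> fg; exact/perm_flatten/perm_map. Qed.

Lemma exotic_count f n : exotic f -> n \in labels f -> count_mem n (labels f) = 2%N.
Proof. by move=> /allP ef /ef /eqP. Qed.

(** * Shuffles and divisions of a forest *)

Lemma interleaves0 (T : Type) (s : seq T) : interleave s [::] = [:: s].
Proof. by case: s. Qed.

(** The unshuffle coproduct, dual to [interleave]. Divisions are counted by positions, so equal
    trees yield repeated entries. *)
Fixpoint splits (T : Type) (s : seq T) : seq (seq T * seq T) :=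
  if s is x :: s' then
    [seq (x :: uv.1, uv.2) | uv <- splits s'] ++
    [seq (uv.1, x :: uv.2) | uv <- splits s']
  else [:: ([::], [::])].

Lemma big_splits_cons (V : nmodType) (T : Type) (x : T) s
    (F : seq T -> seq T -> V) :
  \sum_(uv <- splits (x :: s)) F uv.1 uv.2 =
  \sum_(uv <- splits s) F (x :: uv.1) uv.2 +
  \sum_(uv <- splits s) F uv.1 (x :: uv.2).
Proof. by rewrite big_cat !big_map. Qed.

Lemma splits_map (T T' : Type) (h : T -> T') (s : seq T) :
  splits (map h s) = [seq (map h uv.1, map h uv.2) | uv <- splits s].
Proof.
elim: s => //= x s ->; rewrite map_cat -!map_comp.
by congr cat; apply: eq_map.
Qed.

Lemma splits_perm (T : eqType) (s : seq T) uv :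
  uv \in splits s -> perm_eq (uv.1 ++ uv.2) s.
Proof.
elim: s uv => [|x s IH] uv /=; first by rewrite inE => /eqP->.
rewrite mem_cat => /orP[] /mapP[w ws ->] /=; first by rewrite perm_cons IH.
by rewrite -cat1s perm_catCA cat1s perm_cons IH.
Qed.

(* An element [(b, (a, c))] of [z] is a position of the interleaving [g]: [a] is
   the tree of [g] there, [c] the tree of [f], and [b] tells whether [a] comes
   from [p] or from [q]. *)
Lemma sum_interleave_splits (V : nmodType) (T : eqType) (f p q : seq T)
    (F : seq T -> V) (G : seq T -> seq T -> V) :
  (forall g, size g != size f -> F g = 0) ->
  (forall u v, (size u, size v) != (size p, size q) -> G u v = 0) ->
  (forall z : seq (bool * (T * T)),
     f = [seq x.2.2 | x <- z] ->
     p = [seq x.2.1 | x <- z & x.1] -> q = [seq x.2.1 | x <- z & ~~ x.1] ->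
     F [seq x.2.1 | x <- z] =
     G [seq x.2.2 | x <- z & x.1] [seq x.2.2 | x <- z & ~~ x.1]) ->
  \sum_(g <- interleave p q) F g = \sum_(uv <- splits f) G uv.1 uv.2.
Proof.
elim: f p q F G => [|y f IH] p q F G F0 G0 FG.
  rewrite [RHS]big_seq1 /=.
  case: p q G0 FG => [|a p] [|b q] G0 FG.
  - by rewrite /= big_seq1; have := FG [::]; apply.
  - by rewrite /= big_seq1 F0 // G0.
  - by rewrite /= big_seq1 F0 // G0.
  rewrite G0 // big_seq big1 // => g /interleave_perm/perm_size gE.
  by rewrite F0 // gE.
rewrite big_splits_cons.
(* An interleaving starting with the head of [p] corresponds to a division giving [y] to the left
   part; [IHr] is the mirror case. *)
have IHl a p' : p = a :: p' ->
    \sum_(g <- interleave p' q) F (a :: g) =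
    \sum_(uv <- splits f) G (y :: uv.1) uv.2.
  move=> pE; apply: (IH _ _ (fun g => F (a :: g)) (fun u v => G (y :: u) v)).
  - by move=> g gf; apply: F0.
  - by move=> u v uv; apply: G0; rewrite pE.
  move=> z fE p'E qE; have := FG ((true, (a, y)) :: z); rewrite /=.
  by apply; rewrite ?pE ?fE ?p'E.
have IHr b q' : q = b :: q' ->
    \sum_(g <- interleave p q') F (b :: g) =
    \sum_(uv <- splits f) G uv.1 (y :: uv.2).
  move=> qE; apply: (IH _ _ (fun g => F (b :: g)) (fun u v => G u (y :: v))).
  - by move=> g gf; apply: F0.
  - by move=> u v uv; apply: G0; rewrite qE.
  move=> z fE pE q'E; have := FG ((false, (b, y)) :: z); rewrite /=.
  by apply; rewrite ?qE ?fE ?q'E.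
(* When [p] or [q] is empty, divisions giving [y] to that side have the wrong size and vanish by
   [G0]. *)
case: p q {IH} G0 FG IHl IHr => [|a p] [|b q] G0 FG IHl IHr.
- rewrite /= big_seq1 F0 // !big1 ?addr0 // => uv _; apply: G0 => //.
  by rewrite xpair_eqE andbF.
- rewrite -(IHr b q erefl) /= !big_seq1 big1 ?add0r // => uv _; exact: G0.
- rewrite -(IHl a p erefl) !interleaves0 !big_seq1.
  rewrite [X in _ + X]big1 ?addr0 // => uv _; apply: G0.
  by rewrite xpair_eqE andbF.
by rewrite -(IHl a p erefl) -(IHr b q erefl) [interleave _ _]/= big_cat !big_map.
Qed.

(** A renaming of [g] into [f] restricts to both sublists. Conversely, renamings of the sublists
    glue, because neither [p] and [q] nor [u] and [v] share labels. *)
Lemma class_interleave_eq (z : seq (bool * (dtree * dtree))) :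
  let p := [seq x.2.1 | x <- z & x.1] in
  let q := [seq x.2.1 | x <- z & ~~ x.1] in
  let u := [seq x.2.2 | x <- z & x.1] in
  let v := [seq x.2.2 | x <- z & ~~ x.1] in
  let g := [seq x.2.1 | x <- z] in
  let f := [seq x.2.2 | x <- z] in
  exotic p -> exotic q -> exotic g -> exotic f ->
  {in labels p, forall n, n \notin labels q} ->
  (class g == class f) =
  [&& exotic u, exotic v, class u == class p & class v == class q].
Proof.
move=> p q u v g f ep eq_ eg ef pq.
have gE : perm_eq (labels g) (labels p ++ labels q).
  rewrite -labels_cat; apply: perm_labels; rewrite perm_sym -map_cat.
  by apply: perm_map; rewrite perm_filterC.
have fE : perm_eq (labels f) (labels u ++ labels v).
  rewrite -labels_cat; apply: perm_labels; rewrite perm_sym -map_cat.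
  by apply: perm_map; rewrite perm_filterC.
apply/eqP/and4P => [/(class_eqP eg ef)[s sB fs]|[eu ev]].
  have sI := bij_inj sB.
  have zs x : x \in z -> x.2.2 = trename s x.2.1.
    by move: fs; rewrite /f /g /rename -map_comp => /eq_in_map; apply.
  have -> : u = rename s p.
    rewrite /u /p /rename -map_comp; apply/eq_in_map => x.
    by rewrite mem_filter => /andP[_ /zs].
  have -> : v = rename s q.
    rewrite /v /q /rename -map_comp; apply/eq_in_map => x.
    by rewrite mem_filter => /andP[_ /zs].
  by split; rewrite ?exotic_rename // class_rename // => ? ? _ _ /sI.
move=> /eqP/esym /(class_eqP ep eu)[s /bij_inj sI us].
move=> /eqP/esym /(class_eqP eq_ ev)[s' /bij_inj s'I vs].
(* The two renamings may clash on common values, so the glued map is only injective on the labels of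
   [g], which [class_rename] accepts. *)
pose r n := if n \in labels p then s n else s' n.
have {}us : u = rename r p by rewrite us; apply: rename_in => n np; rewrite /r np.
have {}vs : v = rename r q.
  rewrite vs; apply: rename_in => n nq; rewrite /r ifN //.
  by apply/negP => /pq; rewrite nq.
(* A common label of the exotic [u] and [v] would occur four times in the exotic [f]. *)
have uv n : n \in labels u -> n \in labels v -> false.
  move=> nu nv; have nf : n \in labels f by rewrite (perm_mem fE) mem_cat nu.
  have := exotic_count ef nf; rewrite (permP fE) count_cat.
  by rewrite (exotic_count eu nu) (exotic_count ev nv).
have rp n : n \in labels p -> r n \in labels u.
  by move=> np; rewrite us labels_rename map_f.
have rq n : n \in labels q -> r n \in labels v.
  by move=> nq; rewrite vs labels_rename map_f.
have rI : {in labels g &, injective r}.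
  move=> m n; rewrite !(perm_mem gE) !mem_cat => /orP[mp|mq] /orP[np|nq].
  - by rewrite /r mp np => /sI.
  - by move=> e; move: (uv (r m)); rewrite {2}e => /(_ (rp _ mp) (rq _ nq)).
  - by move=> e; move: (uv (r n)); rewrite -{2}e => /(_ (rp _ np) (rq _ mq)).
  - rewrite /r !ifN => [/s'I //||]; apply/negP => /pq; by rewrite ?mq ?nq.
suff -> : f = rename r g by rewrite class_rename.
rewrite /f /g /rename -map_comp; apply/eq_in_map => x xz /=.
move: us vs; rewrite /u /v /p /q /rename -!map_comp => /eq_in_map us /eq_in_map vs.
have [x1|x1] := boolP x.1; first by apply: us; rewrite mem_filter x1.
by apply: vs; rewrite mem_filter x1.
Qed.

(** * Linear extensions and coefficients of shuffles *)

Section LinearExtension.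
Variables (R : realType) (K : choiceType) (V : lmodType R).
Implicit Types (F : K -> V) (x : {malg R[K]}).

Lemma lin_extEw (A : {fset K}) F x :
  (msupp x `<=` A)%fset -> lin_ext F x = \sum_(k <- A) x@_k *: F k.
Proof.
move=> xA; apply: big_fset_incl => // k _ /mcoeff_outdom ->.
by rewrite scale0r.
Qed.

Lemma lin_ext_is_linear F : linear (lin_ext F : {malg R[K]} -> V).
Proof.
move=> a x y; set A := (msupp x `|` msupp y)%fset.
rewrite !(@lin_extEw A) ?fsubsetUl ?fsubsetUr //; last first.
  apply: fsubset_trans (msuppD_le _ _) _.
  by apply: fsetSU; exact: msuppZ_le.
rewrite scaler_sumr -big_split; apply: eq_bigr => k _ /=.
by rewrite mcoeffD mcoeffZ scalerDl scalerA.
Qed.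

HB.instance Definition _ F :=
  GRing.isLinear.Build R {malg R[K]} V _ (lin_ext F) (lin_ext_is_linear F).

Lemma lin_extU F k : lin_ext F << k >> = F k.
Proof. by rewrite /lin_ext msuppU oner_eq0 big_seq_fset1 mcoeffUU scale1r. Qed.

End LinearExtension.

Lemma malgE1 (R : realType) (K : choiceType) (x : {malg R[K]}) :
  x = \sum_(k <- msupp x) x@_k *: << k >>.
Proof.
rewrite [LHS]monalgE; apply: eq_bigr => k _.
by apply/malgP => l; rewrite mcoeffZ !mcoeffU mulr_natr.
Qed.

Lemma linear_malgE (R : realType) (K : choiceType) (V : lmodType R)
    (F : {linear {malg R[K]} -> V}) x :
  F x = \sum_(k <- msupp x) x@_k *: F << k >>.
Proof.
by rewrite [in LHS](malgE1 x) linear_sum; apply: eq_bigr => k _; rewrite linearZ.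
Qed.

Lemma scalar_malgE (R : realType) (K : choiceType)
    (a : {scalar {malg R[K]}}) x :
  a x = \sum_(k <- msupp x) x@_k * a << k >>.
Proof.
by rewrite [in LHS](malgE1 x) linear_sum; apply: eq_bigr => k _; rewrite linearZ.
Qed.

Lemma mcoeff_lin_ext (R : realType) (K L : choiceType) (F : K -> {malg R[L]}) x l :
  (lin_ext F x)@_l = \sum_(k <- msupp x) x@_k * (F k)@_l.
Proof. by rewrite raddf_sum /=; apply: eq_bigr => k _; rewrite mcoeffZ. Qed.

Lemma sum_mcoeff_eq (R : realType) (K : choiceType) (x : {malg R[K]}) k :
  \sum_(l <- msupp x) x@_l * (k == l)%:R = x@_k.
Proof.
rewrite [in RHS](malgE1 x) raddf_sum /=; apply: eq_bigr => l _.
by rewrite mcoeffZ mcoeffU eq_sym.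
Qed.

(** Extension by zero to lists that are not exotic: the parts of a division of an exotic forest may
    separate a liana. *)
Definition fcoeff (R : realType) (x : EFspan R) (f : dforest) : R :=
  if exotic f then x@_(class f) else 0.

(** The duality between interleavings and divisions is applied to the indicator of equality of
    classes, which [class_interleave_eq] splits into conditions on the two parts. *)
Lemma mcoeff_shuffle_basis (R : realType) p q f : exotic f ->
  (shuffle_basis R p q)@_(class f) =
  \sum_(uv <- splits f)
    ([&& exotic uv.1, exotic uv.2, class uv.1 == p & class uv.2 == q])%:R.
Proof.
move=> ef; rewrite /shuffle_basis raddf_sum /=.
set P := rename double _; set Q := rename _ (rep q).
have eP : exotic P by apply: exotic_rename (exotic_rep p); exact: double_inj.
have eQ : exotic Q.
  by apply: exotic_rename (exotic_rep q) => m n /succn_inj/double_inj.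
have pE : class P = p.
  by rewrite class_rename ?class_rep ?exotic_rep // => m n _ _ /double_inj.
have qE : class Q = q.
  by rewrite class_rename ?class_rep ?exotic_rep // => m n _ _ /succn_inj/double_inj.
have PQ : {in labels P, forall n, n \notin labels Q}.
  move=> n; rewrite !labels_rename => /mapP[m _ ->].
  by apply/negP => /mapP[k _ /(congr1 odd)] /=; rewrite !odd_double.
have sz u r : exotic u -> class u = class r -> exotic r -> size u = size r.
  by move=> eu /(class_eqP eu) ur /ur[s _ ->]; rewrite size_map.
rewrite big_seq (eq_bigr (fun g => (exotic g && (class g == class f))%:R)); last first.
  by move=> g /exotic_interleave ->; rewrite mcoeffU.
rewrite -big_seq.
apply: (sum_interleave_splits (G := fun u v =>
  ([&& exotic u, exotic v, class u == p & class v == q])%:R)).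
- move=> g gf; case: andP => // -[eg /eqP gE].
  by rewrite (sz g f) ?eqxx in gf.
- move=> u v uv; case: and4P => // -[eu ev /eqP uE /eqP vE].
  by rewrite (sz u P) ?(sz v Q) ?eqxx ?pE ?qE in uv.
move=> z fE PE QE; have [eg|eg] /= := boolP (exotic _).
  by rewrite fE class_interleave_eq -?PE -?QE -?fE ?pE ?qE.
(* The list read off from [z] is an interleaving of [P] and [Q], hence exotic. *)
exfalso; move/negP: eg; apply; apply: (@exotic_interleave p q).
rewrite -/P -/Q PE QE.
elim: z {fE PE QE} => //= -[[] [a b]] z IH /=.
  case: [seq _ | x <- z & ~~ x.1] IH => [|c s] IH /=.
    by rewrite interleaves0 inE in IH; rewrite -(eqP IH) inE.
  by rewrite mem_cat map_f.
case: [seq _ | x <- z & x.1] IH => [|c s] IH /=.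
  by rewrite inE in IH; rewrite -(eqP IH) inE.
by rewrite mem_cat (map_f (cons a)) ?orbT.
Qed.

Lemma mcoeff_shuffle (R : realType) (x y : EFspan R) f : exotic f ->
  (shuffle x y)@_(class f) =
  \sum_(uv <- splits f) fcoeff x uv.1 * fcoeff y uv.2.
Proof.
move=> ef; rewrite mcoeff_lin_ext.
under eq_bigr => p _.
  rewrite mcoeff_lin_ext.
  under eq_bigr do rewrite mcoeff_shuffle_basis // mulr_sumr.
  rewrite exchange_big mulr_sumr; over.
rewrite exchange_big; apply: eq_bigr => -[u v] _ /=.
rewrite /fcoeff; have [eu|eu] := boolP (exotic u); last first.
  by rewrite mul0r big1 // => p _; rewrite big1 ?mulr0 // => q _; rewrite mulr0.
have [ev|ev] := boolP (exotic v); last first.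
  by rewrite mulr0 big1 // => p _; rewrite big1 ?mulr0 // => q _; rewrite mulr0.
rewrite -(sum_mcoeff_eq x) mulr_suml; apply: eq_bigr => p _.
rewrite -mulrA; congr (_ * _); rewrite -(sum_mcoeff_eq y) mulr_sumr.
by apply: eq_bigr => q _; case: eqP => _; rewrite ?mul0r ?mulr0 ?mul1r.
Qed.

(** * Integration by parts and the shuffle product *)

(** A Leibniz rule: in each division the replaced tree lies in exactly one of the two parts. *)
Lemma sum_splits_replace_one (V : nmodType) (T : Type) (h : T -> seq T) f
    (F : seq T -> seq T -> V) :
  \sum_(g <- replace_one h f) \sum_(uv <- splits g) F uv.1 uv.2 =
  \sum_(uv <- splits f) (\sum_(g <- replace_one h uv.1) F g uv.2 +
                         \sum_(g <- replace_one h uv.2) F uv.1 g).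
Proof.
elim: f F => [|x f IH] F; first by rewrite /= !big_seq1 /= !big_nil addr0.
rewrite (big_splits_cons _ _ (fun u v => \sum_(g <- replace_one h u) F g v +
  \sum_(g <- replace_one h v) F u g)) /= big_cat !big_map /=.
have -> : \sum_(y <- h x) \sum_(uv <- splits (y :: f)) F uv.1 uv.2 =
    \sum_(uv <- splits f) \sum_(y <- h x) F (y :: uv.1) uv.2 +
    \sum_(uv <- splits f) \sum_(y <- h x) F uv.1 (y :: uv.2).
  rewrite [X in _ = X + _]exchange_big [X in _ = _ + X]exchange_big -big_split.
  by apply: eq_bigr => y _; rewrite big_splits_cons.
have -> : \sum_(g <- replace_one h f) \sum_(uv <- splits (x :: g)) F uv.1 uv.2 =
    \sum_(uv <- splits f) (\sum_(g <- replace_one h uv.1) F (x :: g) uv.2 +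
                           \sum_(g <- replace_one h uv.2) F (x :: uv.1) g) +
    \sum_(uv <- splits f) (\sum_(g <- replace_one h uv.1) F g (x :: uv.2) +
                           \sum_(g <- replace_one h uv.2) F uv.1 (x :: g)).
  rewrite -(IH (fun u v => F (x :: u) v)) -(IH (fun u v => F u (x :: v))).
  by rewrite -big_split; apply: eq_bigr => g _; rewrite big_splits_cons.
rewrite addrACA; congr (_ + _); rewrite -big_split; apply: eq_bigr => uv _;
  rewrite big_cat !big_map /= ?addrA //.
by congr (_ + _); rewrite addrC.
Qed.

Lemma tbulletize_rename s n t : injective s ->
  tbulletize (s n) (trename s t) = trename s (tbulletize n t).
Proof.
move=> sI; elim/dtree_nested_ind: t => [m|ts IH] /=.
  by rewrite (inj_eq sI); case: eqP.
by congr Bullet; elim: ts IH => //= u ts IH [-> /IH ->].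
Qed.

Lemma bulletize_rename s n f : injective s ->
  bulletize (s n) (rename s f) = rename s (bulletize n f).
Proof.
by move=> sI; rewrite /bulletize /rename -!map_comp; apply: eq_map => t;
  exact: tbulletize_rename.
Qed.

Lemma replace_one_map (T T' : Type) (e : T -> T') h h' f :
  foldr (fun t Q => h' (e t) = map e (h t) /\ Q) True f ->
  replace_one h' (map e f) = map (map e) (replace_one h f).
Proof.
elim: f => //= t f IH [tE /IH ->].
by rewrite map_cat tE -!map_comp; congr cat; apply: eq_map.
Qed.

Lemma tgraft_rename s n t :
  tgraft (s n) (trename s t) = map (trename s) (tgraft n t).
Proof.
elim/dtree_nested_ind: t => [m|ts IH] //=; congr cons.
by rewrite (replace_one_map IH) -!map_comp; apply: eq_map.
Qed.

Lemma graft_rename s n f : graft (s n) (rename s f) = map (rename s) (graft n f).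
Proof.
apply: replace_one_map; elim: f => //= t f IH; split => //; exact: tgraft_rename.
Qed.

Lemma bulletize_id n f : n \notin labels f -> bulletize n f = f.
Proof.
have tid t : n \notin tlabels t -> tbulletize n t = t.
  elim/dtree_nested_ind: t => [m|ts IH] /=; first by rewrite inE eq_sym => /negbTE ->.
  move=> nts; congr Bullet; elim: ts IH nts => //= u ts IH [uE tsE].
  by rewrite mem_cat negb_or => /andP[/uE -> /(IH tsE) ->].
elim: f => //= t f IH; rewrite /labels /= mem_cat negb_or => /andP[/tid -> /IH].
by rewrite /bulletize => ->.
Qed.

Lemma exotic_bulletizeE n f : count_mem n (labels f) = 1%N ->
  exotic (bulletize n f) = exotic (Lbl n :: f).
Proof.
move=> nf; apply/idP/idP; last exact: exotic_bulletize.
move=> /allP eb; apply/allP => m; rewrite /labels /= -/(labels f) inE.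
have [->|mn] := eqVneq m n; first by rewrite nf.
rewrite add0n => /= mf.
have := eb m; rewrite count_labels_bulletize (negbTE mn); apply.
by rewrite -has_pred1 has_count count_labels_bulletize (negbTE mn) -has_count has_pred1.
Qed.

Lemma exotic_graftE n f g : g \in graft n f -> exotic g = exotic (Lbl n :: f).
Proof.
move=> /labels_graft gE; rewrite /exotic /labels /= -/(labels f) -/(labels g).
rewrite (perm_all _ gE); apply: eq_all => m /=.
by rewrite (permP gE).
Qed.

Lemma exotic_Lbl n f : exotic (Lbl n :: f) -> count_mem n (labels f) = 1%N.
Proof.
by move=> /(@exotic_count _ n); rewrite /labels /= inE eqxx => /(_ isT) [].
Qed.

(* The image of [opA] consists of the vectors [x] with this property. *)
Definition IBP_invariant (R : realType) (x : EFspan R) : Prop :=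
  forall q, ~~ irreducible q -> x@_q = pairing x (IBP_basis R q).

Lemma pairingU (R : realType) (K : choiceType) (x : {malg R[K]}) k :
  pairing x << k >> = x@_k.
Proof.
rewrite /pairing -[RHS]sum_mcoeff_eq; apply: eq_bigr => l _.
by rewrite mcoeffU.
Qed.

Lemma pairing_is_scalar (R : realType) (K : choiceType) (x : {malg R[K]}) :
  scalar (pairing x).
Proof.
move=> a y z; rewrite /pairing mulr_sumr -big_split; apply: eq_bigr => k _ /=.
by rewrite mcoeffD mcoeffZ mulrDr mulrCA.
Qed.

HB.instance Definition _ (R : realType) (K : choiceType) (x : {malg R[K]}) :=
  GRing.isLinear.Build R {malg R[K]} R *%R (pairing x) (pairing_is_scalar x).

(** [IBP_basis] works on the chosen representative; bulletizing and grafting commute with the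
    renaming that leads to it, so any representative may be used. *)
Lemma pairing_IBP_basis (R : realType) (x : EFspan R) n f : exotic (Lbl n :: f) ->
  pairing x (IBP_basis R (class (Lbl n :: f))) =
  - fcoeff x (bulletize n f) - \sum_(g <- graft n f) fcoeff x g.
Proof.
move=> ef; have [s sB fE] := rep_class ef; have sI := bij_inj sB.
rewrite /IBP_basis fE /= graft_rename big_map.
rewrite (raddfB (pairing x)) (raddfN (pairing x)) (raddf_sum (pairing x)) /=.
rewrite bulletize_rename // /fcoeff exotic_bulletize // pairingU.
have cs g : exotic g -> class (rename s g) = class g.
  by move=> eg; rewrite class_rename // => ? ? _ _ /sI.
rewrite cs ?exotic_bulletize //; congr (_ - _).
by rewrite !big_seq; apply: eq_bigr => g /(exotic_graft ef) eg; rewrite pairingU eg cs.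
Qed.

Lemma class_reducible n f : exotic (Lbl n :: f) ->
  ~~ irreducible (class (Lbl n :: f)).
Proof. by move=> /rep_class[s _]; rewrite /irreducible => ->. Qed.

(** Parts of a division need not be exotic. If [Lbl n :: f] is not, neither are the forests on the
    right, and both sides vanish. *)
Lemma fcoeff_IBP (R : realType) (x : EFspan R) n f :
  IBP_invariant x -> count_mem n (labels f) = 1%N ->
  fcoeff x (Lbl n :: f) =
  - fcoeff x (bulletize n f) - \sum_(g <- graft n f) fcoeff x g.
Proof.
move=> xI nf; have [ef|ef] := boolP (exotic (Lbl n :: f)).
  by rewrite -pairing_IBP_basis // /fcoeff ef xI ?class_reducible.
rewrite /fcoeff exotic_bulletizeE // (negbTE ef) big_seq big1 ?subr0 ?oppr0 //.
by move=> g /exotic_graftE ->; rewrite (negbTE ef).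
Qed.

(** This discards the divisions that separate the two ends of a liana. *)
Lemma fcoeff_count1 (R : realType) (x : EFspan R) n f :
  count_mem n (labels f) = 1%N -> fcoeff x f = 0.
Proof.
move=> nf; rewrite /fcoeff; case: ifP => // ef.
by have := exotic_count ef (n := n); rewrite nf -has_pred1 has_count nf => /(_ isT).
Qed.

(* Both members [n] of the liana lie on the same side of every splitting that
   contributes, so [IBP] acts as a derivation. *)
Lemma shuffle_IBP_invariant (R : realType) (x y : EFspan R) :
  IBP_invariant x -> IBP_invariant y -> IBP_invariant (shuffle x y).
Proof.
move=> xI yI q; rewrite -[q]class_rep; have := exotic_rep q.
case: (rep q) => [|[n|ts] f] ef;
  try by have [s _ e] := rep_class ef; rewrite /irreducible e.
move=> _; rewrite pairing_IBP_basis // mcoeff_shuffle //.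
rewrite [fcoeff _ (bulletize n f)]/fcoeff exotic_bulletize //.
rewrite mcoeff_shuffle ?exotic_bulletize //.
have -> : \sum_(g <- graft n f) fcoeff (shuffle x y) g =
   \sum_(g <- graft n f) \sum_(uv <- splits g) fcoeff x uv.1 * fcoeff y uv.2.
  rewrite !big_seq; apply: eq_bigr => g /(exotic_graft ef) eg.
  by rewrite /fcoeff eg mcoeff_shuffle.
rewrite (sum_splits_replace_one _ _ (fun u v => fcoeff x u * fcoeff y v)).
rewrite (big_splits_cons _ _ (fun u v => fcoeff x u * fcoeff y v)).
rewrite splits_map big_map -opprD -!big_split -sumrN !big_seq.
apply: eq_bigr => -[u v] /splits_perm /= /perm_labels fE.
have {fE} : (count_mem n (labels u) + count_mem n (labels v))%N = 1%N.
  by rewrite -count_cat -labels_cat (permP fE) exotic_Lbl.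
rewrite -/(graft n u) -/(graft n v) -/(bulletize n u) -/(bulletize n v).
(* A part without [n] is unchanged by [bulletize]; as a new root or a grafted leaf, [n] would occur
   in it only once, which kills the coefficient. *)
have abs (z : EFspan R) w : count_mem n (labels w) = 0%N ->
  [/\ bulletize n w = w, fcoeff z (Lbl n :: w) = 0 &
      \sum_(g <- graft n w) fcoeff z g = 0].
  move=> nw; split; first by apply: bulletize_id; rewrite -has_pred1 has_count nw.
    by apply: (@fcoeff_count1 _ _ n); rewrite /labels /= -/(labels w) eqxx nw.
  rewrite big_seq big1 // => g /labels_graft gE; apply: (@fcoeff_count1 _ _ n).
  by rewrite (permP gE) /= eqxx nw.
rewrite -mulr_suml -mulr_sumr.
(* The counts in [u] and [v] add up to one: a single part holds the other end of the liana and
   receives the whole action of [IBP]. *)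
case nu: (count_mem n (labels u)) => [|[|//]].
  rewrite add0n => nv; have [-> -> ->] := abs x u nu.
  by rewrite (fcoeff_IBP yI nv) !mul0r !add0r -opprD mulrN mulrDr.
move=> [] nv; have [-> -> ->] := abs y v nv.
by rewrite (fcoeff_IBP xI nu) !mulr0 !addr0 -opprD mulNr mulrDl.
Qed.

Lemma shuffle_character (R : realType) (a : {scalar EFspan R}) x y :
  is_shuffle_character a -> a (shuffle x y) = a x * a y.
Proof.
move=> ac; rewrite [in RHS](scalar_malgE a x) [in RHS](scalar_malgE a y).
rewrite /shuffle {1}/lin_ext linear_sum mulr_suml; apply: eq_bigr => p _.
rewrite linearZ /= -mulrA; congr (_ * _).
rewrite /lin_ext linear_sum mulr_sumr; apply: eq_bigr => q _.
by rewrite linearZ /= mulrCA ac /shuffle !lin_extU.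
Qed.

(** * Finiteness *)

(** An integer leaf is half a liana; doubling the order keeps the weights integral and additive over
    trees. *)
Fixpoint tweight (t : dtree) : nat :=
  match t with
  | Lbl _ => 1
  | Bullet ts => (sumn (map tweight ts)).+2
  end.

Definition fweight (f : dforest) : nat := sumn (map tweight f).

(* Twice the order of the exotic forest. *)
Definition weight (p : EF) : nat := fweight (rep p).

Lemma fweight_rename s f : fweight (rename s f) = fweight f.
Proof.
rewrite /fweight /rename -map_comp; congr sumn; apply: eq_map => t /=.
elim/dtree_nested_ind: t => //= ts IH; congr _.+2.
by elim: ts IH => //= u ts IH [-> /IH ->].
Qed.

Lemma weight_class f : exotic f -> weight (class f) = fweight f.
Proof. by move=> /rep_class[s _ e]; rewrite /weight e fweight_rename. Qed.

Lemma size_rep_class f : exotic f -> size (rep (class f)) = size f.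
Proof. by move=> /rep_class[s _ ->]; rewrite size_map. Qed.

Lemma fweight_bulletize n f :
  fweight (bulletize n f) = (fweight f + count_mem n (labels f))%N.
Proof.
have tw t : tweight (tbulletize n t) = (tweight t + count_mem n (tlabels t))%N.
  elim/dtree_nested_ind: t => [m|ts IH] /=; first by case: eqP.
  rewrite !addSn; congr _.+2.
  elim: ts IH => //= u ts IH [-> /IH ->]; rewrite count_cat.
  by rewrite addnACA.
elim: f => // t f IH; rewrite /fweight /labels /= tw count_cat.
by move: IH; rewrite /fweight /labels => ->; rewrite addnACA.
Qed.

Lemma fweight_graft n f g : g \in graft n f -> fweight g = (fweight f).+1.
Proof.
pose P t := forall u, u \in tgraft n t -> tweight u = (tweight t).+1.
have H ts us : foldr (fun t Q => P t /\ Q) True ts ->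
    us \in replace_one (tgraft n) ts -> fweight us = (fweight ts).+1.
  elim: ts us => //= t ts IH us [Pt /IH Hts].
  rewrite mem_cat => /orP[] /mapP[v vI ->]; rewrite /fweight /=.
    by rewrite (Pt v vI).
  by have := Hts v vI; rewrite /fweight => ->; rewrite addnS.
have Pt t : P t.
  elim/dtree_nested_ind: t => //= ts IH u.
  rewrite inE => /predU1P[-> //|/mapP[us usI ->]] /=.
  by have := H ts us IH usI; rewrite /fweight => ->.
by apply: H; elim: f.
Qed.

Lemma size_replace_one (T : eqType) (h : T -> seq T) f g :
  g \in replace_one h f -> size g = size f.
Proof.
elim: f g => //= t f IH g; rewrite mem_cat => /orP[] /mapP[v vI ->] //=.
by rewrite (IH v).
Qed.

(** The removed root costs weight one. Turning the other end into a bullet, or grafting a leaf,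
    restores it without adding a tree. *)
Lemma IBP_basis_supp (R : realType) p k : (IBP_basis R p)@_k != 0 ->
  weight k = weight p /\ (size (rep k) < size (rep p))%N.
Proof.
rewrite /IBP_basis {2}/weight; have := exotic_rep p.
case: (rep p) => [|[n|ts] f] ef; rewrite ?mcoeff0 ?eqxx //.
rewrite mcoeffB mcoeffN mcoeffU raddf_sum /=.
have [<- _|kb] := eqVneq _ k.
  have eb := exotic_bulletize ef.
  rewrite weight_class // size_rep_class // fweight_bulletize exotic_Lbl //.
  by rewrite size_map addn1.
rewrite oppr0 add0r oppr_eq0 => kg.
have [/hasP[g gI /eqP <-]|/hasPn nk] := boolP (has (fun g => class g == k) (graft n f)).
  have eg := exotic_graft ef gI.
  rewrite weight_class // size_rep_class // (fweight_graft gI).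
  by rewrite (size_replace_one gI).
by rewrite big_seq big1 ?eqxx // in kg => g /nk /negbTE; rewrite mcoeffU => ->.
Qed.

Lemma IBP_basis_irreducible (R : realType) p : irreducible p -> IBP_basis R p = 0.
Proof. by rewrite /IBP_basis /irreducible; case: (rep p) => [|[]]. Qed.

(** The same fuel bounds the children of the first tree and the remaining trees, since both weigh
    less than the whole. *)
Fixpoint bounded_forests (N w : nat) : seq dforest :=
  if w is w'.+1 then
    [::] :: [seq t :: f | t <- map Lbl (iota 0 N) ++ map Bullet (bounded_forests N w'),
                          f <- bounded_forests N w']
  else [:: [::]].

Lemma tweight_gt0 t : (0 < tweight t)%N.
Proof. by case: t. Qed.

Lemma mem_bounded_forests N w f :
  (fweight f <= w)%N -> {in labels f, forall n, (n < N)%N} ->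
  f \in bounded_forests N w.
Proof.
elim: w f => [|w IH] [|t f] //=; rewrite /fweight /=.
  by have := tweight_gt0 t; lia.
move=> wf lf; rewrite inE /=; apply: allpairs_f.
  case: t wf lf => [n|ts] /= wf lf; rewrite mem_cat.
    by rewrite map_f // mem_iota /= lf // inE eqxx.
  rewrite [X in _ || X]map_f ?orbT //; apply: IH; rewrite /fweight; first lia.
  by move=> n nts; apply: lf; rewrite /labels /= mem_cat nts.
apply: IH; rewrite /fweight; first by have := tweight_gt0 t; lia.
by move=> n nf; apply: lf; rewrite /labels /= mem_cat nf orbT.
Qed.

Lemma size_labels f : (size (labels f) <= fweight f)%N.
Proof.
have tl t : (size (tlabels t) <= tweight t)%N.
  elim/dtree_nested_ind: t => //= ts IH; do 2 apply: leqW.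
  by elim: ts IH => //= u ts IH [uE /IH tsE]; rewrite size_cat leq_add.
by elim: f => //= t f IH; rewrite /labels /= size_cat leq_add.
Qed.

Lemma finite_weight w : exists A : {fset EF}, forall p, (weight p <= w)%N -> p \in A.
Proof.
exists [fset class f | f in bounded_forests w w]%fset => p pw.
(* Renaming each label to its first position makes all labels smaller than their number, hence than
   [w]. *)
have sI : {in labels (rep p) &, injective (index^~ (labels (rep p)))}.
  by move=> m n mp np; exact: index_inj.
rewrite -[p]class_rep -(class_rename sI (exotic_rep p)).
apply: in_imfset; apply: mem_bounded_forests; first by rewrite fweight_rename.
move=> n; rewrite labels_rename => /mapP[m mp ->].
by rewrite (leq_trans _ pw) // (leq_trans _ (size_labels _)) // index_mem.
Qed.

(** * The operators RED and A *)

Definition RED_step (R : realType) (x : EFspan R) : EFspan R := id_IR x + IBP x.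

Lemma RED_step_is_linear (R : realType) : linear (@RED_step R).
Proof. by move=> a x y; rewrite /RED_step /id_IR /IBP !linearP scalerDr addrACA. Qed.

HB.instance Definition _ (R : realType) :=
  GRing.isLinear.Build R (EFspan R) (EFspan R) _ (@RED_step R) (@RED_step_is_linear R).

Lemma RED_stepU (R : realType) p :
  @RED_step R << p >> = if irreducible p then << p >> else IBP_basis R p.
Proof.
rewrite /RED_step /id_IR /IBP !lin_extU.
by case: ifP => [/IBP_basis_irreducible->|_]; rewrite ?addr0 ?add0r.
Qed.

Lemma iter_RED_step_is_linear (R : realType) n : linear (iter n (@RED_step R)).
Proof. by elim: n => // n IH a x y /=; rewrite IH linearP. Qed.

HB.instance Definition _ (R : realType) n :=
  GRing.isLinear.Build R (EFspan R) (EFspan R) _ (iter n (@RED_step R))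
    (@iter_RED_step_is_linear R n).

(** Irreducible forests are fixed, and on the others each step removes a tree. With no tree left the
    forest is empty, hence irreducible. *)
Lemma iter_RED_step_supp (R : realType) n p k : (size (rep p) <= n)%N ->
  (iter n (@RED_step R) << p >>)@_k != 0 -> irreducible k /\ weight k = weight p.
Proof.
elim: n p => [|n IH] p.
  rewrite leqn0 size_eq0 mcoeffU => /eqP pE.
  by case: (eqVneq p k) => [<-|]; rewrite ?eqxx // /irreducible pE.
rewrite iterSr RED_stepU; have [pI _|pI pn] := boolP (irreducible p).
  suff -> : iter n (@RED_step R) << p >> = << p >>.
    by rewrite mcoeffU; case: (eqVneq p k) => [<-|]; rewrite ?eqxx.
  by elim: n {IH} => //= n ->; rewrite RED_stepU pI.
rewrite linear_malgE raddf_sum /= => kn.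
have [|/hasPn nh] := boolP (has (fun l => ((IBP_basis R p)@_l != 0) &&
   ((iter n (@RED_step R) << l >>)@_k != 0)) (msupp (IBP_basis R p))).
  move=> /hasP[l _ /andP[/IBP_basis_supp[<- ln] kl]]; apply: IH kl.
  by rewrite -ltnS (leq_trans ln).
rewrite big_seq big1 ?eqxx // in kn => l /nh.
rewrite negb_and !negbK => /orP[] /eqP e; by rewrite mcoeffZ e ?mul0r ?mulr0.
Qed.

Lemma RED_step_id (R : realType) (x : EFspan R) :
  (forall k, x@_k != 0 -> irreducible k) -> RED_step x = x.
Proof.
move=> xI; rewrite linear_malgE [RHS]malgE1 !big_seq; apply: eq_bigr => k.
by rewrite -mcoeff_neq0 => /xI kI; rewrite /= RED_stepU kI.
Qed.

Lemma REDE (R : realType) p n : (size (rep p) <= n)%N ->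
  RED (<< p >> : EFspan R) = iter n (@RED_step R) << p >>.
Proof.
have eqn m m' : (size (rep p) <= m)%N -> (m <= m')%N ->
    iter m' (@RED_step R) << p >> = iter m (@RED_step R) << p >>.
  move=> pm /subnK <-; rewrite iterD; elim: (m' - m)%N => //= d ->.
  by apply: RED_step_id => k /(iter_RED_step_supp pm)[].
move=> pn; rewrite /RED /stationary_lim; apply: xget_unique => [|y [N Ny]].
  by exists n => m nm; exact: eqn.
(* Another eventual value is compared at an index beyond both thresholds. *)
rewrite -(Ny (maxn N n)) ?leq_maxl //; apply: (eqn n _ pn); exact: leq_maxr.
Qed.

Lemma RED_supp (R : realType) p k :
  (RED (<< p >> : EFspan R))@_k != 0 -> irreducible k /\ weight k = weight p.
Proof. by rewrite (REDE R (leqnn _)); exact: iter_RED_step_supp. Qed.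

Lemma RED_irreducible (R : realType) p :
  irreducible p -> RED (<< p >> : EFspan R) = << p >>.
Proof.
move=> pI; rewrite (REDE R (leqnn _)); elim: (size _) => //= n ->.
by rewrite RED_stepU pI.
Qed.

Lemma RED_reducible (R : realType) p : ~~ irreducible p ->
  RED (<< p >> : EFspan R) =
  \sum_(k <- msupp (IBP_basis R p)) (IBP_basis R p)@_k *: RED << k >>.
Proof.
(* One iteration more than necessary is taken: the first is a step of [IBP], and the others suffice
   for the smaller forests it produces. *)
move=> pI; rewrite (REDE R (leqnSn _)) iterSr RED_stepU (negbTE pI).
rewrite linear_malgE !big_seq; apply: eq_bigr => k; rewrite -mcoeff_neq0.
by move=> /IBP_basis_supp[_ /ltnW kp]; rewrite (REDE R kp).
Qed.

Lemma mcoeff_opA (R : realType) (x : IRspan R) q :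
  (opA x)@_q = \sum_(p <- msupp x) x@_p * (RED << q >>)@_(val p).
Proof.
rewrite mcoeff_lin_ext; apply: eq_bigr => p _; congr (_ * _).
(* [RED] preserves the weight, so [A] contains every forest contributing to the sum over all of
   [EF]. *)
have [A AP] := finite_weight (weight (val p)).
have pE r : pairing << val p >> (RED << r >> : EFspan R) = (RED << r >>)@_(val p).
  by rewrite /pairing msuppU oner_eq0 big_seq_fset1 mcoeffUU mul1r.
under eq_fsbigr do rewrite pE.
have out r : (RED (<< r >> : EFspan R))@_(val p) != 0 -> r \in A.
  by move=> /RED_supp[_ pr]; apply: AP; rewrite pr.
rewrite (fsbigTE A) => [|r rA]; last first.
  apply/eqP; apply: contraNT rA => rp; apply: out.
  by apply: contraNneq rp => ->; rewrite scale0r.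
rewrite raddf_sum /=.
have [qA|qA] := boolP (q \in A).
  rewrite (big_fsetD1 q) //= mcoeffZ mcoeffUU mulr1 big1_fset ?addr0 // => r.
  by rewrite in_fsetD1 => /andP[rq _] _; rewrite mcoeffZ mcoeffU (negbTE rq) mulr0.
rewrite big1_fset => [|r rA _]; last first.
  rewrite mcoeffZ mcoeffU; case: eqVneq => [e|_]; last by rewrite mulr0.
  by rewrite -e rA in qA.
by apply/esym/eqP; apply: contraNT qA; exact: out.
Qed.

(** * The image of [opA] and the adjoint of [IBP] *)

Lemma pairingE (R : realType) (K : choiceType) (x y : {malg R[K]}) :
  pairing x y = \sum_(k <- msupp y) y@_k * x@_k.
Proof.
rewrite scalar_malgE; apply: eq_bigr => k _.
by rewrite /= pairingU.
Qed.

Lemma mcoeff_incl (R : realType) (x : IRspan R) (p : IRF) :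
  (incl x)@_(val p) = x@_p.
Proof.
rewrite mcoeff_lin_ext -[RHS]sum_mcoeff_eq; apply: eq_bigr => q _.
by rewrite mcoeffU (inj_eq val_inj) eq_sym.
Qed.

Lemma mcoeff_incl0 (R : realType) (x : IRspan R) k :
  ~~ irreducible k -> (incl x)@_k = 0.
Proof.
move=> kI; rewrite mcoeff_lin_ext big1 // => p _; rewrite mcoeffU.
by case: eqVneq kI => [<-|]; rewrite ?mulr0 // (valP p).
Qed.

Definition restrict (R : realType) : EFspan R -> IRspan R :=
  lin_ext (fun k => oapp (fun p : IRF => << p >>) 0 (insub k)).

Lemma mcoeff_restrict (R : realType) (x : EFspan R) (p : IRF) :
  (restrict x)@_p = x@_(val p).
Proof.
rewrite mcoeff_lin_ext -[RHS]sum_mcoeff_eq; apply: eq_bigr => k _.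
case: insubP => [q _ <-|kI] /=; first by rewrite mcoeffU (inj_eq val_inj) eq_sym.
by case: eqVneq kI => [<-|]; rewrite ?mcoeff0 // (valP p).
Qed.

(** This presents [opA] as the adjoint of [RED]. *)
Lemma mcoeff_opA_incl (R : realType) (x : IRspan R) q :
  (opA x)@_q = pairing (incl x) (RED << q >>).
Proof.
rewrite mcoeff_opA pairingE /incl.
under [RHS]eq_bigr do rewrite mcoeff_lin_ext mulr_sumr.
rewrite exchange_big; apply: eq_bigr => p _.
rewrite -(sum_mcoeff_eq (RED << q >>)) mulr_sumr; apply: eq_bigr => k _.
by rewrite mcoeffU mulrCA.
Qed.

(** On a reducible forest, [RED] takes the same value as on its image under [IBP]. *)
Lemma opA_IBP_invariant (R : realType) (x : IRspan R) : IBP_invariant (opA x).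
Proof.
move=> q qI; rewrite mcoeff_opA_incl RED_reducible // (linear_sum (pairing (incl x))).
rewrite pairingE; apply: eq_bigr => k _.
by rewrite (scalarZ (pairing (incl x))) mcoeff_opA_incl.
Qed.

(** Induction on the number of trees, which [IBP] lowers; [RED] fixes irreducible forests. *)
Lemma IBP_invariant_RED (R : realType) (x : EFspan R) q :
  IBP_invariant x -> x@_q = pairing x (RED << q >>).
Proof.
move=> xI; have [n] := ubnP (size (rep q)); elim: n q => // n IH q qn.
have [qI|qI] := boolP (irreducible q); first by rewrite RED_irreducible // pairingU.
rewrite xI // RED_reducible // (linear_sum (pairing x)) pairingE !big_seq.
apply: eq_bigr => k; rewrite -mcoeff_neq0 => /IBP_basis_supp[_ kq].
by rewrite (scalarZ (pairing x)) IH // (leq_trans kq).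
Qed.

(** Only irreducible forests occur in [RED], and there [x] and its restriction agree. *)
Lemma opA_restrict (R : realType) (x : EFspan R) :
  IBP_invariant x -> opA (restrict x) = x.
Proof.
move=> xI; apply/malgP => q; rewrite mcoeff_opA_incl IBP_invariant_RED //.
rewrite !pairingE !big_seq; apply: eq_bigr => k.
rewrite -mcoeff_neq0 => /RED_supp[kI _]; congr (_ * _).
by have := mcoeff_incl (restrict x) (Sub k kI); rewrite mcoeff_restrict.
Qed.

Lemma opA_irreducible (R : realType) (x : IRspan R) (p : IRF) :
  (opA x)@_(val p) = x@_p.
Proof. by rewrite mcoeff_opA_incl RED_irreducible ?(valP p) // pairingU mcoeff_incl. Qed.

Lemma opA_inj (R : realType) : injective (@opA R).
Proof. by move=> x y e; apply/malgP => p; rewrite -!opA_irreducible e. Qed.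

Lemma mcoeff_adjoint_IBP (R : realType) (x : EFspan R) q :
  (adjoint (@IBP R) x)@_q = pairing x (IBP_basis R q).
Proof.
(* The sum of the weights is a crude bound for each weight in the support of [x]; preservation of
   weight then makes [z] vanish outside [A]. *)
have [A AP] := finite_weight (\sum_(k <- msupp x) weight k).
pose z : EFspan R := [malg k in A => pairing x (IBP_basis R k)].
have zE k : z@_k = pairing x (IBP_basis R k).
  rewrite mcoeffE; case: ifPn => // kA; rewrite /pairing big_seq big1 // => l lx.
  have [->|/IBP_basis_supp[lk _]] := eqVneq (IBP_basis R k)@_l 0; first by rewrite mulr0.
  case/negP: kA; apply: AP; rewrite -lk.
  by rewrite (big_rem l lx) /= leq_addr.
have zP y : pairing z y = pairing x (IBP y).
  rewrite pairingE /IBP /lin_ext (linear_sum (pairing x)); apply: eq_bigr => k _.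
  by rewrite (scalarZ (pairing x)) zE.
rewrite -pairingU; have -> : IBP_basis R q = IBP << q >> by rewrite /IBP lin_extU.
(* Existence of [z] is enough: the value chosen by [xget] then satisfies the defining property,
   which determines its coefficients. *)
rewrite /adjoint; set P := (X in xget 0 X); have : P (xget 0 P); last exact.
by apply: xgetPex; exists z.
Qed.

(** * The character property for the modified shuffle product *)

Theorem proposition4p21 (R : realType) (a_w : {scalar EFspan R})
    (a_w_character : is_shuffle_character a_w) (p1 p2 : IRF) :
  let S := shuffle (opA (<< p1 >> : IRspan R)) (opA << p2 >>) in
  let p12 : IRspan R := mod_shuffle << p1 >> << p2 >> in
  [/\ exists z : IRspan R, opA z = S,
      incl p12 = S - adjoint (@IBP R) S
    & a_mu a_w << p1 >> * a_mu a_w << p2 >> = a_mu a_w p12].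
Proof.
move=> S p12.
have SI : IBP_invariant S by apply: shuffle_IBP_invariant; exact: opA_IBP_invariant.
have SE := opA_restrict SI.
have p12E : p12 = restrict S.
  (* [S] has a preimage, unique by injectivity of [opA], so [opA_inv] does not return its default
     value. *)
  by apply: xget_unique => [//|y yE]; apply: opA_inj; rewrite yE SE.
split; first by exists (restrict S).
  apply/malgP => q; rewrite mcoeffB mcoeff_adjoint_IBP p12E.
  (* At a reducible forest the right side cancels by invariance of [S]; at an irreducible one the
     adjoint contributes nothing. *)
  have [qI|qI] := boolP (irreducible q); last by rewrite mcoeff_incl0 // SI // subrr.
  rewrite IBP_basis_irreducible // (linear0 (pairing S)) subr0.
  by have := mcoeff_incl (restrict S) (Sub q qI); rewrite mcoeff_restrict.
by rewrite /a_mu /= p12E SE shuffle_character.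
Qed.
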